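(* Let $\alpha\neq0$ be a real number. Any rotational timelike $K^\alpha$-translator with lightlike axis, normalized so that the axis is spanned by $(0,1,1)$ and the speed is $\vec v=(0,-1,-1)$, is parametrized by $X(r,t)=(2rt,\,f(r)+r-rt^2,\,f(r)-r-rt^2)$, where $$f(r)=\begin{cases} -m\displaystyle\int^r e^{-4t^2}\,dt,\quad m>0, & \alpha=\frac12,\\[2mm] -\displaystyle\int^r\Big(\frac{2(2\alpha-1)}{\alpha}t^2+m\Big)^{\frac{2\alpha}{1-2\alpha}}dt,\quad m\in\mathbb R, & \alpha\neq\frac12.\end{cases}$$ The maximal domain of the function $f(r)$ is: 1. Case $\alpha=1/2$: $(0,\infty)$. 2. Case $\alpha\in(0,1/2)$: $\Big(0,\sqrt{\frac{\alpha}{2(1-2\alpha)}m}\Big)$, and $m>0$. 3. Case $\alpha\notin[0,1/2]$: $(0,\infty)$ if $m\ge0$, and $\Big(\sqrt{\frac{\alpha}{2(1-2\alpha)}m},\infty\Big)$ if $m<0$.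
   Context: $\mathbb R_1^3$ is $\mathbb R^3$ with the metric $\langle,\rangle=dx^2+dy^2-dz^2$. A surface is timelike if its induced metric is Lorentzian; then its (local) unit normal $N$ satisfies $\langle N,N\rangle=\epsilon=1$. The Gauss curvature is $K=\epsilon\det(A)$, where $AU=-\nabla^0_U N$ is the Weingarten map and $\nabla^0$ is the Levi-Civita connection of $\mathbb R_1^3$. In a local parametrization $X(u,v)$, $$K=-\frac{\det(X_u,X_v,X_{uu})\det(X_u,X_v,X_{vv})-\det(X_u,X_v,X_{uv})^2}{(EG-F^2)^2},$$ where $E=\langle X_u,X_u\rangle$, $F=\langle X_u,X_v\rangle$, $G=\langle X_v,X_v\rangle$. A timelike surface is a timelike $K^\alpha$-translator with speed $\vec v$ if $K>0$ and $K^\alpha=\langle N,\vec v\rangle$ everywhere, for a choice of unit normal $N$. A surface of revolution with axis spanned by $(0,1,1)$ is one parametrized by $X(r,t)=(2rt,\,f(r)+r-rt^2,\,f(r)-r-rt^2)$ with $f$ smooth on an interval of $r>0$; it is timelike iff $f'<0$. The symbol $\int^r$ denotes an antiderivative (defined up to an additive constant), and $m$ is a constant of integration. The maximal domain of $f$ is the largest open interval in $(0,\infty)$ on which the formula defines a smooth function for which $X$ is timelike with $K>0$ and satisfies the translator equation; only the values of $m$ listed give a nonempty domain. *)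

(* Defs.v *)
From Stdlib Require Import Reals ZArith.
From Coquelicot Require Import Coquelicot.
Open Scope R_scope.

(** * Minkowski space $\mathbb R^3_1$ *)

Definition vec3 : Type := (R * R * R)%type.

Definition crd1 (p : vec3) : R := fst (fst p).
Definition crd2 (p : vec3) : R := snd (fst p).
Definition crd3 (p : vec3) : R := snd p.

Definition mink (p q : vec3) : R :=
  crd1 p * crd1 q + crd2 p * crd2 q - crd3 p * crd3 q.

(** The linear combination [- (a p + b q)]. *)
Definition neg_comb (a : R) (p : vec3) (b : R) (q : vec3) : vec3 :=
  (- (a * crd1 p + b * crd1 q),
   - (a * crd2 p + b * crd2 q),
   - (a * crd3 p + b * crd3 q)).

(** * Parametrized surfaces, on a set [U] of parameters *)

Definition d_u (Y : R -> R -> vec3) (u v : R) : vec3 :=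
  (Derive (fun s => crd1 (Y s v)) u,
   Derive (fun s => crd2 (Y s v)) u,
   Derive (fun s => crd3 (Y s v)) u).

Definition d_v (Y : R -> R -> vec3) (u v : R) : vec3 :=
  (Derive (fun s => crd1 (Y u s)) v,
   Derive (fun s => crd2 (Y u s)) v,
   Derive (fun s => crd3 (Y u s)) v).

Definition differentiable3 (Y : R -> R -> vec3) (u v : R) : Prop :=
  differentiable_pt (fun s t => crd1 (Y s t)) u v /\
  differentiable_pt (fun s t => crd2 (Y s t)) u v /\
  differentiable_pt (fun s t => crd3 (Y s t)) u v.

(** The form [E du^2 + 2 F du dv + G dv^2] has signature (1,1): the plane has
    a basis [(a,b)], [(c,d)] that is orthonormal with signs [+], [-]. *)
Definition lorentzian (E F G : R) : Prop :=
  exists a b c d : R,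
    E * a ^ 2 + 2 * F * (a * b) + G * b ^ 2 = 1 /\
    E * (a * c) + F * (a * d + b * c) + G * (b * d) = 0 /\
    E * c ^ 2 + 2 * F * (c * d) + G * d ^ 2 = -1.

Definition timelike (X : R -> R -> vec3) (U : R -> R -> Prop) : Prop :=
  forall u v, U u v ->
    lorentzian (mink (d_u X u v) (d_u X u v))
               (mink (d_u X u v) (d_v X u v))
               (mink (d_v X u v) (d_v X u v)).

(** A unit normal of a timelike surface is spacelike, whence the [1]. *)
Definition unit_normal (X N : R -> R -> vec3) (U : R -> R -> Prop) : Prop :=
  forall u v, U u v ->
    differentiable3 N u v /\
    mink (N u v) (N u v) = 1 /\
    mink (N u v) (d_u X u v) = 0 /\
    mink (N u v) (d_v X u v) = 0.

(** [[a b; c d]] is the matrix, in the basis [(X_u, X_v)], of the Weingarten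
    map [A W = - D_W N]; the connection of flat space is the usual derivative:
    [A X_u = - N_u = a X_u + c X_v] and [A X_v = - N_v = b X_u + d X_v]. *)
Definition weingarten (X N : R -> R -> vec3) (u v a b c d : R) : Prop :=
  d_u N u v = neg_comb a (d_u X u v) c (d_v X u v) /\
  d_v N u v = neg_comb b (d_u X u v) d (d_v X u v).

(** [K = epsilon det A] with [epsilon = <N, N>]. *)
Definition gauss_curvature (X N : R -> R -> vec3) (u v K : R) : Prop :=
  exists a b c d : R,
    weingarten X N u v a b c d /\
    K = mink (N u v) (N u v) * (a * d - b * c).

Definition timelike_translator (alpha : R) (w : vec3)
    (X : R -> R -> vec3) (U : R -> R -> Prop) : Prop :=
  timelike X U /\
  exists N : R -> R -> vec3,
    unit_normal X N U /\
    forall u v, U u v ->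
      exists K : R,
        gauss_curvature X N u v K /\
        0 < K /\
        Rpower K alpha = mink (N u v) w.

(** * Surfaces of revolution with lightlike axis spanned by (0,1,1) *)

Definition itv (a b : Rbar) (r : R) : Prop := Rbar_lt a r /\ Rbar_lt r b.

Definition smooth_on (f : R -> R) (a b : Rbar) : Prop :=
  forall (n : nat) (r : R), itv a b r -> ex_derive_n f n r.

Definition rot_surface (f : R -> R) (r t : R) : vec3 :=
  (2 * r * t, f r + r - r * t ^ 2, f r - r - r * t ^ 2).

(** The profile [f] lives on the nonempty open interval [(a,b)] of
    [(0,+oo)]; the rotation parameter [t] ranges over all of [R]. *)
Definition rot_translator (alpha : R) (a b : Rbar) (f : R -> R) : Prop :=
  Rbar_le 0 a /\ Rbar_lt a b /\
  smooth_on f a b /\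
  timelike_translator alpha (0, -1, -1) (rot_surface f)
    (fun r _ => itv a b r).

(** * The explicit profiles *)

(** [x ^ p] is defined and equal to [y]. For a negative base this needs an
    integer exponent: [Rpower] would return the junk value [1] there, whereas
    e.g. for [alpha = 1/4] the profile is a polynomial, defined everywhere. *)
Definition is_power (x p y : R) : Prop :=
  (0 < x /\ y = Rpower x p) \/
  (x = 0 /\ 0 < p /\ y = 0) \/
  (x < 0 /\ exists k : Z, p = IZR k /\ y = powerRZ x k).

(** The integrand at [r] is defined and equal to [y]. *)
Definition integrand (alpha m r y : R) : Prop :=
  (alpha = 1 / 2 /\ y = m * exp (- 4 * r ^ 2)) \/
  (alpha <> 1 / 2 /\
   is_power (2 * (2 * alpha - 1) / alpha * r ^ 2 + m)
            (2 * alpha / (1 - 2 * alpha)) y).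

(** [f] is, on [(a,b)], minus an antiderivative of the integrand. *)
Definition profile (alpha m : R) (a b : Rbar) (f : R -> R) : Prop :=
  forall r, itv a b r ->
    exists y : R, integrand alpha m r y /\ is_derive f r (- y).

Definition admissible (alpha m : R) (a b : Rbar) : Prop :=
  exists f : R -> R, profile alpha m a b f /\ rot_translator alpha a b f.

Definition maximal_domain (alpha m : R) (a b : Rbar) : Prop :=
  admissible alpha m a b /\
  forall a' b' : Rbar, admissible alpha m a' b' ->
    forall r, itv a' b' r -> itv a b r.

Definition no_domain (alpha m : R) : Prop :=
  forall a b : Rbar, ~ admissible alpha m a b.

(* Main.v *)
Require Import Defs.
From Stdlib Require Import Reals ZArith Lra.
From Coquelicot Require Import Coquelicot.
Open Scope R_scope.

(** Along [rot_surface f] one has [E = 4 f'], [F = 0] and [G = 4 r^2], so the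
    surface is timelike iff [f' < 0]. With [y = -1 / f'] and [h = sqrt y], the
    unit normal with [<N, (0,-1,-1)> > 0] is determined by [h], this product
    equals [h], and the principal curvatures are [h' / 2] and [h / (2 r)]. Hence
    [K = y' / (8 r)], and the translator equation becomes
    [y' = 8 r y^(1/(2 alpha))]. It linearizes: [ln y - 4 r^2] is constant if
    [alpha = 1/2], and otherwise [y^(1 - 1/(2 alpha)) - 2 (2 alpha - 1)/alpha r^2]
    is. The constant of integration must make this power of [y] positive, which
    gives the maximal domains. *)

(** * Calculus on open intervals with possibly infinite ends *)

Lemma itv_locally (a b : Rbar) (r : R) : itv a b r -> locally r (itv a b).
Proof.
  intros [Ha Hb].
  apply filter_and; [now apply open_Rbar_gt | now apply open_Rbar_lt].
Qed.

Lemma itv_inhabited (a b : Rbar) : Rbar_lt a b -> exists r, itv a b r.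
Proof.
  unfold itv; destruct a as [a| |], b as [b| |]; simpl; intros H; try easy.
  - exists ((a + b) / 2); lra.
  - exists (a + 1); split; [lra | easy].
  - exists (b - 1); split; [easy | lra].
  - now exists 0.
Qed.

Lemma itv_between (a b : Rbar) (r s t : R) :
  itv a b r -> itv a b s -> Rmin r s <= t <= Rmax r s -> itv a b t.
Proof.
  intros [Hr1 Hr2] [Hs1 Hs2] [H1 H2]; split.
  - eapply Rbar_lt_le_trans with (Finite (Rmin r s)); [|exact H1].
    now apply Rmin_case.
  - eapply Rbar_le_lt_trans with (Finite (Rmax r s)); [exact H2|].
    now apply Rmax_case.
Qed.

Lemma itv_pos (a b : Rbar) (r : R) : Rbar_le 0 a -> itv a b r -> 0 < r.
Proof. intros H [Ha _]; exact (Rbar_le_lt_trans 0 a r H Ha). Qed.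

(** Integrating from an interior point [c] keeps every segment of integration inside the interval,
    so the ends may be infinite or singular for [g]. *)
Lemma antiderivative_on (a b : Rbar) (g : R -> R) :
  Rbar_lt a b -> (forall r, itv a b r -> continuous g r) ->
  exists F, forall r, itv a b r -> is_derive F r (g r).
Proof.
  intros Hab Hg.
  destruct (itv_inhabited a b Hab) as [c Hc].
  exists (RInt g c); intros r Hr.
  apply (is_derive_RInt g (RInt g c) c r); [|now apply Hg].
  generalize (itv_locally a b r Hr); apply filter_imp; intros s Hs.
  apply (RInt_correct g), (ex_RInt_continuous g).
  intros t Ht; apply Hg; exact (itv_between a b c s t Hc Hs Ht).
Qed.

Lemma constant_on_itv (a b : Rbar) (F : R -> R) :
  (forall r, itv a b r -> is_derive F r 0) ->
  forall r s, itv a b r -> itv a b s -> F r = F s.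
Proof.
  intros HF.
  assert (H : forall r s, itv a b r -> itv a b s -> r < s -> F r = F s).
  { intros r s Hr Hs Hrs.
    apply (eq_is_derive F r s); [|exact Hrs].
    intros t Ht; apply HF, (itv_between a b r s t Hr Hs).
    rewrite Rmin_left, Rmax_right; lra. }
  intros r s Hr Hs.
  destruct (Rtotal_order r s) as [L|[E|L]].
  - now apply H.
  - now rewrite E.
  - now symmetry; apply H.
Qed.

(** * Real powers and smoothness *)

Lemma is_derive_Rpower (y : R -> R) (r dy q : R) :
  0 < y r -> is_derive y r dy ->
  is_derive (fun s => Rpower (y s) q) r (q * Rpower (y r) (q - 1) * dy).
Proof.
  intros Hy Hd.
  replace (q * Rpower (y r) (q - 1) * dy)
    with (dy * (q * Rpower (y r) (q - 1))) by ring.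
  apply (is_derive_comp (fun x => Rpower x q) y); [|exact Hd].
  now apply is_derive_Reals, derivable_pt_lim_power.
Qed.

Lemma Rpower_pos (x p : R) : 0 < Rpower x p.
Proof. apply exp_pos. Qed.

Lemma Rpower_minus1 (x : R) : 0 < x -> Rpower x (- (1)) = / x.
Proof. intros Hx; now rewrite Rpower_Ropp, Rpower_1. Qed.

Lemma Rpower_swap (x p z : R) :
  0 < x -> p <> 0 -> Rpower x p = z -> x = Rpower z (/ p).
Proof.
  intros Hx Hp <-.
  rewrite Rpower_mult, Rinv_r by exact Hp; now rewrite Rpower_1.
Qed.

(** By induction on the order, each iterated derivative agrees on the interval with a member of [P].
    Agreement there suffices because the interval is open and derivatives are local. *)
Lemma smooth_of_closed_class (P : (R -> R) -> Prop) (a b : Rbar) :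
  (forall F, P F -> exists G, P G /\ forall r, itv a b r -> is_derive F r (G r)) ->
  forall F, P F -> smooth_on F a b.
Proof.
  intros HP F HF.
  assert (H : forall n, exists G, P G /\
            forall r, itv a b r -> Derive_n F n r = G r).
  { induction n as [|n [G [PG EG]]].
    - now exists F.
    - destruct (HP G PG) as [G' [PG' DG]].
      exists G'; split; [exact PG'|]; intros r Hr; simpl.
      rewrite (Derive_ext_loc _ G).
      + now apply is_derive_unique, DG.
      + generalize (itv_locally a b r Hr); apply filter_imp; exact EG. }
  intros [|n] r Hr; [exact I|].
  destruct (H n) as [G [PG EG]].
  destruct (HP G PG) as [G' [_ DG]].
  simpl; apply (ex_derive_ext_loc G).
  - generalize (itv_locally a b r Hr); apply filter_imp.
    intros s Hs; symmetry; now apply EG.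
  - exists (G' r); now apply DG.
Qed.

(** Arbitrary real exponents are allowed because differentiating a power of [y] brings in the factor
    [8 r y^k], where [k] will be [1 / (2 alpha)]. *)
Inductive power_algebra (y : R -> R) : (R -> R) -> Prop :=
| pa_const c : power_algebra y (fun _ => c)
| pa_id : power_algebra y (fun r => r)
| pa_power q : power_algebra y (fun r => Rpower (y r) q)
| pa_plus F G : power_algebra y F -> power_algebra y G ->
    power_algebra y (fun r => F r + G r)
| pa_mult F G : power_algebra y F -> power_algebra y G ->
    power_algebra y (fun r => F r * G r).

(* The equation for [y] makes its power algebra closed under derivation. *)
Lemma power_algebra_smooth (a b : Rbar) (y F : R -> R) (k : R) :
  (forall r, itv a b r -> 0 < y r) ->
  (forall r, itv a b r -> is_derive y r (8 * r * Rpower (y r) k)) ->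
  power_algebra y F -> smooth_on F a b.
Proof.
  intros Hy Hd; revert F; apply smooth_of_closed_class.
  intros F HF; induction HF as [c| |q|F G HF [F' [PF DF]] HG [G' [PG DG]]
                               |F G HF [F' [PF DF]] HG [G' [PG DG]]].
  - exists (fun _ => 0); split; [constructor|].
    intros r _; apply (is_derive_const c r).
  - exists (fun _ => 1); split; [constructor|].
    intros r _; apply (is_derive_id r).
  - exists (fun r => q * Rpower (y r) (q - 1) * (8 * r * Rpower (y r) k)); split.
    + repeat (apply pa_mult || constructor).
    + intros r Hr; apply is_derive_Rpower; auto.
  - exists (fun r => F' r + G' r); split; [now constructor|].
    intros r Hr; apply (is_derive_plus F G); auto.
  - exists (fun r => F' r * G r + F r * G' r); split.
    + apply pa_plus; now apply pa_mult.
    + intros r Hr; apply (is_derive_mult F G); auto.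
      intros; apply Rmult_comm.
Qed.

(** This passes from [f' = - 1 / y], which lies in the power algebra of [y], to [f], which need not.
    Order [S n] for [f] is order [n] for [g]. *)
Lemma smooth_antiderivative (a b : Rbar) (f g : R -> R) :
  (forall r, itv a b r -> is_derive f r (g r)) ->
  smooth_on g a b -> smooth_on f a b.
Proof.
  intros Hf Hg [|n] r Hr; [exact I|].
  destruct n as [|n].
  - exists (g r); now apply Hf.
  - assert (E : forall s, itv a b s -> Derive_n f (S n) s = Derive_n g n s).
    { intros s Hs.
      replace (S n) with (n + 1)%nat by (rewrite Nat.add_comm; reflexivity).
      rewrite <- (Derive_n_comp f n 1 s).
      apply Derive_n_ext_loc.
      generalize (itv_locally a b s Hs); apply filter_imp.
      intros u Hu; simpl; now apply is_derive_unique, Hf. }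
    generalize (Hg (S n) r Hr); simpl; apply ex_derive_ext_loc.
    generalize (itv_locally a b r Hr); apply filter_imp.
    intros s Hs; symmetry; now apply (E s Hs).
Qed.

(** Every coordinate of the unit normal has this separated form, and [unit_normal] asks for joint
    differentiability, not only for partial derivatives. *)
Lemma differentiable_separated (u v w : R -> R) (x y : R) :
  ex_derive u x -> ex_derive v x -> ex_derive w y ->
  differentiable_pt (fun s t => u s + v s * w t) x y.
Proof.
  intros [du Hu] [dv Hv] [dw Hw].
  apply is_derive_Reals in Hu, Hv, Hw.
  assert (P1 := fun h l H => differentiable_pt_lim_proj1_0 h x y l H).
  apply P1 in Hu, Hv.
  assert (Hw' : differentiable_pt_lim (fun _ t => w t) x y 0 dw).
  { apply filterdiff_differentiable_pt_lim.
    eapply filterdiff_ext_lin.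
    - apply (filterdiff_comp' (fun p : R * R => snd p) w).
      + apply filterdiff_linear, is_linear_snd.
      + apply is_derive_Reals in Hw; exact Hw.
    - intros [p q]; simpl; unfold scal; simpl; unfold mult; simpl; ring. }
  apply filterdiff_differentiable_pt_lim in Hu, Hv, Hw'.
  exists (du + dv * w y), (v x * dw).
  apply filterdiff_differentiable_pt_lim.
  eapply filterdiff_ext_lin.
  - apply (filterdiff_plus_fct (fun p : R * R => u (fst p))
             (fun p : R * R => v (fst p) * w (snd p))); [exact Hu|].
    apply (filterdiff_mult_fct (fun p : R * R => v (fst p))
             (fun p : R * R => w (snd p)) (x, y)); [|exact Hv|exact Hw'].
    intros; apply Rmult_comm.
  - intros [p q]; simpl; unfold plus, mult, scal; simpl; unfold mult; simpl; ring.
Qed.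

(** * First fundamental form, unit normal and curvature of the rotational surface *)

Lemma d_u_rot (f : R -> R) (r t df : R) :
  is_derive f r df ->
  d_u (rot_surface f) r t = (2 * t, df + 1 - t ^ 2, df - 1 - t ^ 2).
Proof.
  intros Hf; assert (Ef : Derive (fun s => f s) r = df) by now apply is_derive_unique.
  assert (Hx : ex_derive f r) by now exists df.
  unfold d_u, rot_surface, crd1, crd2, crd3; simpl.
  f_equal; [f_equal|]; apply is_derive_unique; auto_derive; auto;
    try rewrite Ef; ring.
Qed.

Lemma d_v_rot (f : R -> R) (r t : R) :
  d_v (rot_surface f) r t = (2 * r, - (2 * r * t), - (2 * r * t)).
Proof.
  unfold d_v, rot_surface, crd1, crd2, crd3; simpl.
  f_equal; [f_equal|]; apply is_derive_unique; auto_derive; auto; ring.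
Qed.

(** The form is diagonal and its second coefficient is positive, so a vector of square -1 exists
    only if the first coefficient is negative. *)
Lemma lorentzian_rot (r df : R) :
  0 < r -> lorentzian (4 * df) 0 (4 * r ^ 2) <-> df < 0.
Proof.
  intros Hr; split.
  - intros (a & b & c & d & _ & _ & H).
    apply Rnot_le_lt; intros Hdf.
    assert (0 <= df * c ^ 2) by (apply Rmult_le_pos; [lra | apply pow2_ge_0]).
    assert (0 <= (r * d) ^ 2) by apply pow2_ge_0.
    nra.
  - intros Hdf.
    assert (Hs : 0 < sqrt (- df)) by (apply sqrt_lt_R0; lra).
    assert (Hq : sqrt (- df) ^ 2 = - df) by (rewrite <- Rsqr_pow2; apply Rsqr_sqrt; lra).
    (* The basis consists of the second and the first coordinate vectors, rescaled to squares 1 and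
       -1. *)
    exists 0, (/ (2 * r)), (/ (2 * sqrt (- df))), 0.
    split; [|split].
    + field; lra.
    + ring.
    + replace df with (- sqrt (- df) ^ 2) by lra.
      rewrite Ropp_involutive, sqrt_pow2 by lra; field; lra.
Qed.

Lemma first_form_rot (f : R -> R) (r t df : R) :
  is_derive f r df ->
  mink (d_u (rot_surface f) r t) (d_u (rot_surface f) r t) = 4 * df /\
  mink (d_u (rot_surface f) r t) (d_v (rot_surface f) r t) = 0 /\
  mink (d_v (rot_surface f) r t) (d_v (rot_surface f) r t) = 4 * r ^ 2.
Proof.
  intros Hf; rewrite (d_u_rot f r t df Hf), d_v_rot.
  unfold mink, crd1, crd2, crd3; simpl; repeat split; ring.
Qed.

(* Here [h] stands for [<N, (0,-1,-1)> = 1 / sqrt (- f' r)]. *)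
Definition rot_normal (h t : R) : vec3 :=
  (- (t * h), (h * t ^ 2 - / h - h) / 2, (h * t ^ 2 - / h + h) / 2).

(** Orthogonality to both tangent vectors leaves a line, the unit condition leaves two opposite
    vectors on it, and the sign of the product with the speed selects one. *)
Lemma rot_normal_unique (r t h : R) (n : vec3) :
  0 < r -> 0 < h ->
  mink n n = 1 ->
  mink n (2 * t, - / h ^ 2 + 1 - t ^ 2, - / h ^ 2 - 1 - t ^ 2) = 0 ->
  mink n (2 * r, - (2 * r * t), - (2 * r * t)) = 0 ->
  0 < mink n (0, -1, -1) ->
  n = rot_normal h t.
Proof.
  destruct n as [[p q] s]; unfold mink, rot_normal, crd1, crd2, crd3; simpl.
  intros Hr Hh H1 H2 H3 H4.
  assert (Ep : p = t * (q - s)) by (apply (Rmult_eq_reg_l (2 * r)); lra).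
  subst p.
  (* Here [g] is [- f']. In the null coordinates [q + s] and [q - s], orthogonality is linear and
     the unit condition reduces to [(q - s)^2 g = 1]. *)
  set (g := / (h * (h * 1))) in *.
  assert (Eg : g * h * h = 1) by (unfold g; field; lra).
  assert (Es : q + s = (q - s) * (g - t * t)) by lra.
  assert (E1 : (q - s) * ((q - s) * g) = 1).
  { replace ((q - s) * g) with (q + s + (q - s) * (t * t)) by lra; lra. }
  assert (Hg : 0 < g) by (unfold g; apply Rinv_0_lt_compat; nra).
  assert (Eh : s - q = h).
  (* Since [s - q] is the product with the speed, its positivity rules out [s - q = - h]. *)
  { assert (E : (s - q - h) * ((s - q + h) * g) = 0) by lra.
    apply Rmult_integral in E; destruct E as [E|E]; [lra|].
    assert (0 < (s - q + h) * g) by (apply Rmult_lt_0_compat; lra); lra. }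
  replace (/ h) with (g * h) by (unfold g; field; lra).
  f_equal; [f_equal|]; nra.
Qed.

Lemma d_u_rot_normal (h : R -> R) (r t dh : R) :
  0 < h r -> is_derive h r dh ->
  d_u (fun s t => rot_normal (h s) t) r t =
    (- (t * dh), (dh * t ^ 2 + dh / h r ^ 2 - dh) / 2,
     (dh * t ^ 2 + dh / h r ^ 2 + dh) / 2).
Proof.
  intros Hp Hh; assert (Eh : Derive (fun s => h s) r = dh) by now apply is_derive_unique.
  assert (Hx : ex_derive h r) by now exists dh.
  unfold d_u, rot_normal, crd1, crd2, crd3; simpl.
  f_equal; [f_equal|]; apply is_derive_unique; auto_derive;
    repeat split; auto; try lra; rewrite Eh; field; lra.
Qed.

Lemma d_v_rot_normal (h : R -> R) (r t : R) :
  d_v (fun s t => rot_normal (h s) t) r t = (- h r, h r * t, h r * t).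
Proof.
  unfold d_v, rot_normal, crd1, crd2, crd3; simpl.
  f_equal; [f_equal|]; apply is_derive_unique; auto_derive; auto; field.
Qed.

(** The Weingarten map is diagonal in the coordinate basis, with eigenvalues [dh / 2] and
    [h r / (2 r)]. The equivalence serves both to read off a given [K] and to exhibit one. *)
Lemma rot_normal_curvature (f h : R -> R) (r t dh K : R) :
  0 < r -> 0 < h r -> is_derive f r (- / h r ^ 2) -> is_derive h r dh ->
  gauss_curvature (rot_surface f) (fun s t => rot_normal (h s) t) r t K <->
  K = h r * dh / (4 * r).
Proof.
  intros Hr Hh Hf Hd.
  unfold gauss_curvature, weingarten.
  rewrite (d_u_rot f r t _ Hf), d_v_rot, (d_u_rot_normal h r t dh Hh Hd),
    d_v_rot_normal.
  assert (E1 : mink (rot_normal (h r) t) (rot_normal (h r) t) = 1).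
  { unfold mink, rot_normal, crd1, crd2, crd3; simpl; field; lra. }
  rewrite E1; unfold neg_comb, crd1, crd2, crd3; simpl.
  split.
  - intros (a & b & c & d & [Hu Hv] & ->).
    injection Hu as U1 U2 U3; injection Hv as V1 V2 V3.
    (* The last two coordinates of [X_t] coincide, so their difference isolates the coefficients
       along [X_r]. Once [b = 0], the determinant is [a * d]. *)
    assert (Ea : a = dh / 2) by lra.
    assert (Eb : b = 0) by lra.
    subst a b.
    assert (Ed : d = h r / (2 * r)).
    { apply (Rmult_eq_reg_r (2 * r)); [|lra].
      replace (h r / (2 * r) * (2 * r)) with (h r) by (field; lra); lra. }
    subst d; field; lra.
  - intros ->.
    exists (dh / 2), 0, 0, (h r / (2 * r)); repeat split.
    + f_equal; [f_equal|]; field; lra.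
    + f_equal; [f_equal|]; field; lra.
    + field; lra.
Qed.

(** The curvature sees [N] only through its value and first partial derivatives. This allows a given
    normal to be replaced by [rot_normal], with which it is known to agree only on the domain. *)
Lemma gauss_curvature_ext (X N M : R -> R -> vec3) (U : R -> R -> Prop) (u v K : R) :
  locally u (fun s => U s v) -> locally v (fun t => U u t) ->
  (forall s t, U s t -> N s t = M s t) ->
  gauss_curvature X N u v K -> gauss_curvature X M u v K.
Proof.
  intros Hu Hv E (a & b & c & d & [Wu Wv] & EK).
  exists a, b, c, d; unfold weingarten.
  assert (Eu : d_u M u v = d_u N u v).
  { unfold d_u; f_equal; [f_equal|]; apply Derive_ext_loc;
      generalize Hu; apply filter_imp; intros s Hs; now rewrite (E s v Hs). }
  assert (Ev : d_v M u v = d_v N u v).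
  { unfold d_v; f_equal; [f_equal|]; apply Derive_ext_loc;
      generalize Hv; apply filter_imp; intros s Hs; now rewrite (E u s Hs). }
  rewrite Eu, Ev, <- (E u v (locally_singleton _ _ Hu)); auto.
Qed.

(** * Equivalence of the translator condition with the differential equation for [y] *)

Lemma mink_rot_normal_speed (h t : R) : mink (rot_normal h t) (0, -1, -1) = h.
Proof. unfold mink, rot_normal, crd1, crd2, crd3; simpl; lra. Qed.

Lemma translator_ode (alpha : R) (a b : Rbar) (f : R -> R) :
  alpha <> 0 -> rot_translator alpha a b f ->
  forall r, itv a b r ->
    Derive f r < 0 /\
    is_derive (fun s => - / Derive f s) r
      (8 * r * Rpower (- / Derive f r) (/ (2 * alpha))).
Proof.
  intros Ha (Ha0 & Hab & Hsm & HT & N & HN & HK).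
  assert (Hpos : forall r, itv a b r -> 0 < r) by (intro; now apply itv_pos).
  assert (Hf : forall r, itv a b r -> is_derive f r (Derive f r)).
  { intros r Hr; apply Derive_correct; exact (Hsm 1%nat r Hr). }
  assert (Hneg : forall r, itv a b r -> Derive f r < 0).
  { intros r Hr; specialize (HT r 0 Hr).
    destruct (first_form_rot f r 0 _ (Hf r Hr)) as (HE & HF & HG).
    rewrite HE, HF, HG in HT; exact (proj1 (lorentzian_rot r _ (Hpos r Hr)) HT). }
  set (y := fun s => - / Derive f s).
  assert (Hy : forall r, itv a b r -> 0 < y r).
  { intros r Hr; unfold y.
    assert (/ Derive f r < 0) by (apply Rinv_lt_0_compat; auto); lra. }
  set (h := fun s => sqrt (y s)).
  assert (Hh : forall r, itv a b r -> 0 < h r).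
  { intros r Hr; apply sqrt_lt_R0; auto. }
  assert (Hh2 : forall r, itv a b r -> h r ^ 2 = y r).
  { intros r Hr; unfold h; rewrite <- Rsqr_pow2; apply Rsqr_sqrt.
    left; auto. }
  assert (Hfh : forall r, itv a b r -> is_derive f r (- / h r ^ 2)).
  { intros r Hr; rewrite Hh2 by exact Hr; unfold y.
    replace (- / - / Derive f r) with (Derive f r); auto.
    specialize (Hneg r Hr); field; lra. }
  assert (EN : forall r t, itv a b r -> N r t = rot_normal (h r) t).
  { intros r t Hr.
    destruct (HN r t Hr) as (_ & H1 & H2 & H3).
    destruct (HK r t Hr) as (K & _ & _ & H4).
    rewrite (d_u_rot f r t _ (Hfh r Hr)) in H2; rewrite d_v_rot in H3.
    apply (rot_normal_unique r); auto.
    (* The product with the speed equals a real power of [K], hence is positive; this fixes the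
       choice between the two unit normals. *)
    rewrite <- H4; apply Rpower_pos. }
  intros r Hr; split; [now apply Hneg|].
  assert (Dy : is_derive y r (Derive y r)).
  { apply Derive_correct; unfold y.
    assert (ex_derive (Derive f) r) by exact (Hsm 2%nat r Hr).
    specialize (Hneg r Hr).
    auto_derive; repeat split; auto; lra. }
  assert (Dh : is_derive h r (Derive y r / (2 * h r)))
    by (apply is_derive_sqrt; auto).
  destruct (HK r 0 Hr) as (K & HGC & K0 & HKa).
  apply (gauss_curvature_ext _ _ (fun s t => rot_normal (h s) t)
           (fun s _ => itv a b s)) in HGC;
    [|now apply itv_locally|now apply filter_forall; intro|intros; now apply EN].
  apply (rot_normal_curvature f h r 0 (Derive y r / (2 * h r)) K) in HGC; auto.
  rewrite EN, mink_rot_normal_speed in HKa by exact Hr.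
  apply Rpower_swap in HKa; auto.
  assert (Hr0 := Hpos r Hr); assert (Hhr := Hh r Hr).
  fold y; fold (y r).
  replace (8 * r * Rpower (y r) (/ (2 * alpha))) with (Derive y r); [exact Dy|].
  (* As [y = h^2], the power [y^(1/(2 alpha))] is [h^(1/alpha)], which the translator equation
     identifies with [K]. *)
  rewrite <- Hh2, <- Rpower_pow, Rpower_mult by auto.
  replace (INR 2 * / (2 * alpha)) with (/ alpha) by (simpl; field; exact Ha).
  rewrite <- HKa, HGC; field; lra.
Qed.

(** Taking [y] as separate data allows a closed formula for [y] to be supplied first and [f] to be
    any antiderivative of [- 1 / y]. *)
Lemma ode_translator (alpha : R) (a b : Rbar) (f y : R -> R) :
  alpha <> 0 -> Rbar_le 0 a -> Rbar_lt a b ->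
  (forall r, itv a b r -> 0 < y r) ->
  (forall r, itv a b r ->
     is_derive y r (8 * r * Rpower (y r) (/ (2 * alpha)))) ->
  (forall r, itv a b r -> is_derive f r (- / y r)) ->
  rot_translator alpha a b f.
Proof.
  intros Ha Ha0 Hab Hy Dy Hf.
  assert (Hpos : forall r, itv a b r -> 0 < r) by (intro; now apply itv_pos).
  set (h := fun s => sqrt (y s)).
  assert (Hh : forall r, itv a b r -> 0 < h r).
  { intros r Hr; apply sqrt_lt_R0; auto. }
  assert (Hh2 : forall r, itv a b r -> h r ^ 2 = y r).
  { intros r Hr; unfold h; rewrite <- Rsqr_pow2; apply Rsqr_sqrt.
    left; auto. }
  assert (Hfh : forall r, itv a b r -> is_derive f r (- / h r ^ 2)).
  { intros r Hr; rewrite Hh2; auto. }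
  assert (Dh : forall r, itv a b r -> is_derive h r
            (8 * r * Rpower (y r) (/ (2 * alpha)) / (2 * h r))).
  { intros r Hr; apply is_derive_sqrt; auto. }
  split; [exact Ha0|]; split; [exact Hab|]; split; [|split].
  (* Written as a constant times a power of [y], the derivative of [f] belongs to the power
     algebra. *)
  - apply (smooth_antiderivative a b f (fun r => -1 * Rpower (y r) (- (1)))).
    + intros r Hr; rewrite Rpower_minus1 by auto.
      replace (-1 * / y r) with (- / y r) by ring; auto.
    + apply (power_algebra_smooth a b y _ (/ (2 * alpha))); auto.
      repeat (apply pa_mult || constructor).
  - intros r t Hr.
    destruct (first_form_rot f r t _ (Hf r Hr)) as (-> & -> & ->).
    apply lorentzian_rot; auto.
    assert (0 < / y r) by (apply Rinv_0_lt_compat; auto); lra.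
  - exists (fun r t => rot_normal (h r) t); split.
    + intros r t Hr.
      specialize (Hh r Hr).
      split; [|rewrite (d_u_rot f r t _ (Hfh r Hr)), d_v_rot;
               unfold mink, rot_normal, crd1, crd2, crd3; simpl;
               split; [|split]; field; lra].
      assert (Eh : ex_derive h r) by (eexists; now apply Dh).
      unfold differentiable3, rot_normal, crd1, crd2, crd3; simpl.
      assert (S : forall (F : R -> R -> R) u v w, (forall s t, u s + v s * w t = F s t) ->
        ex_derive u r -> ex_derive v r -> ex_derive w t -> differentiable_pt F r t).
      { intros F u v w E Hu Hv Hw.
        destruct (differentiable_separated u v w r t Hu Hv Hw) as (lx & ly & L).
        exists lx, ly; revert L; apply differentiable_pt_lim_ext.
        apply locally_2d_forall; exact E. }
      split; [|split].
      * apply (S _ (fun _ => 0) (fun s => - h s) (fun t => t));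
          [intros; ring | auto_derive; repeat split; auto; lra ..].
      * apply (S _ (fun s => (- / h s - h s) / 2) (fun s => h s / 2) (fun t => t ^ 2));
          [intros; simpl; lra | auto_derive; repeat split; auto; lra ..].
      * apply (S _ (fun s => (- / h s + h s) / 2) (fun s => h s / 2) (fun t => t ^ 2));
          [intros; simpl; lra | auto_derive; repeat split; auto; lra ..].
    + intros r t Hr.
      assert (Hr0 := Hpos r Hr); assert (Hhr := Hh r Hr).
      (* The equation for [y] gives [h' = 4 r y^(1/(2 alpha)) / h], so [h h' / (4 r)] is this power;
         raised to [alpha] it becomes [sqrt y = h]. *)
      exists (Rpower (y r) (/ (2 * alpha))); split; [|split].
      * apply (rot_normal_curvature f h r t _ _ Hr0 Hhr (Hfh r Hr) (Dh r Hr)).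
        field; lra.
      * apply Rpower_pos.
      * rewrite mink_rot_normal_speed, Rpower_mult.
        replace (/ (2 * alpha) * alpha) with (/ 2) by (field; exact Ha).
        apply Rpower_sqrt; auto.
Qed.

(** * Integration of the differential equation *)

Definition base (alpha m r : R) : R := 2 * (2 * alpha - 1) / alpha * r ^ 2 + m.

Lemma is_derive_base (alpha m r : R) :
  is_derive (base alpha m) r (2 * (2 * alpha - 1) / alpha * (2 * r)).
Proof. unfold base; auto_derive; auto; ring. Qed.

(** With [k = 1 / (2 alpha)], the factor [y^(-k)] from the chain rule cancels [y^k] and leaves
    [8 (1 - k) r]. For [alpha = 1/2] both sides vanish, so that case calls for the logarithm
    instead. *)
Lemma ode_linearize (alpha r : R) (y : R -> R) :
  alpha <> 0 -> 0 < y r ->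
  is_derive y r (8 * r * Rpower (y r) (/ (2 * alpha))) ->
  is_derive (fun s => Rpower (y s) (1 - / (2 * alpha))) r
    (2 * (2 * alpha - 1) / alpha * (2 * r)).
Proof.
  intros Ha Hy Dy.
  replace (2 * (2 * alpha - 1) / alpha * (2 * r)) with
    ((1 - / (2 * alpha)) * Rpower (y r) (1 - / (2 * alpha) - 1)
       * (8 * r * Rpower (y r) (/ (2 * alpha)))).
  - now apply is_derive_Rpower.
  - replace (1 - / (2 * alpha) - 1) with (- / (2 * alpha)) by ring.
    rewrite Rpower_Ropp.
    assert (H := Rpower_pos (y r) (/ (2 * alpha))); field; lra.
Qed.

(** The exponent [q = 2 alpha / (2 alpha - 1)] is inverse to [1 - 1/(2 alpha)]; hence
    [q - 1 = q / (2 alpha)], and the remaining constants multiply to 8. *)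
Lemma base_ode (alpha m r : R) :
  alpha <> 0 -> alpha <> 1 / 2 -> 0 < base alpha m r ->
  is_derive (fun s => Rpower (base alpha m s) (2 * alpha / (2 * alpha - 1))) r
    (8 * r * Rpower (Rpower (base alpha m r) (2 * alpha / (2 * alpha - 1)))
               (/ (2 * alpha))).
Proof.
  intros Ha Ha2 HB.
  rewrite Rpower_mult.
  replace (8 * r * Rpower (base alpha m r)
             (2 * alpha / (2 * alpha - 1) * / (2 * alpha)))
    with (2 * alpha / (2 * alpha - 1) *
          Rpower (base alpha m r) (2 * alpha / (2 * alpha - 1) - 1) *
          (2 * (2 * alpha - 1) / alpha * (2 * r))).
  - apply is_derive_Rpower, is_derive_base; exact HB.
  - replace (2 * alpha / (2 * alpha - 1) - 1)
      with (2 * alpha / (2 * alpha - 1) * / (2 * alpha)) by (field; lra).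
    field; lra.
Qed.

Lemma translator_profile (alpha : R) (a b : Rbar) (f : R -> R) :
  alpha <> 0 -> rot_translator alpha a b f ->
  exists m, (alpha = 1 / 2 -> 0 < m) /\ profile alpha m a b f.
Proof.
  intros Ha HT.
  assert (HO := translator_ode alpha a b f Ha HT).
  destruct HT as (_ & Hab & Hsm & _).
  set (y := fun s => - / Derive f s) in *.
  assert (Hy : forall r, itv a b r -> 0 < y r).
  { intros r Hr; destruct (HO r Hr) as [H _]; unfold y.
    apply Rinv_lt_0_compat in H; lra. }
  assert (Hf : forall r, itv a b r -> is_derive f r (- / y r)).
  { intros r Hr; replace (- / y r) with (Derive f r).
    - apply Derive_correct; exact (Hsm 1%nat r Hr).
    - destruct (HO r Hr) as [H _]; unfold y; field; lra. }
  destruct (itv_inhabited a b Hab) as [r0 Hr0].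
  destruct (Req_dec alpha (1 / 2)) as [E|NE].
  - set (F := fun s => ln (y s) - 4 * s ^ 2).
    assert (HF : forall r, itv a b r -> is_derive F r 0).
    { intros r Hr; destruct (HO r Hr) as [_ D]; fold y in D; fold (y r) in D.
      replace (/ (2 * alpha)) with 1 in D by (subst alpha; field).
      rewrite Rpower_1 in D by auto.
      assert (Dln : is_derive (fun s => ln (y s)) r (8 * r)).
      { replace (8 * r) with (8 * r * y r * / y r)
          by (field; apply Rgt_not_eq, Hy, Hr).
        apply (is_derive_comp ln y); [apply is_derive_ln; auto | exact D]. }
      replace 0 with (8 * r - 8 * r) by ring.
      apply (is_derive_minus (fun s => ln (y s)) (fun s => 4 * s ^ 2)).
      - exact Dln.
      - auto_derive; auto; ring. }
    (* Constancy of [ln y - 4 r^2] means that [1 / y] is [exp (- 4 r^2)] times this positive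
       constant. *)
    exists (exp (- F r0)); split; [intros _; apply exp_pos|].
    intros r Hr; exists (/ y r); split; [left; split; [exact E|]|now apply Hf].
    rewrite <- exp_plus, (constant_on_itv a b F HF r0 r Hr0 Hr); unfold F.
    replace (- (ln (y r) - 4 * r ^ 2) + - 4 * r ^ 2) with (- ln (y r)) by ring.
    rewrite exp_Ropp, exp_ln; auto.
  - set (Z := fun s => Rpower (y s) (1 - / (2 * alpha))).
    set (F := fun s => Z s - base alpha 0 s).
    assert (HF : forall r, itv a b r -> is_derive F r 0).
    { intros r Hr; destruct (HO r Hr) as [_ D].
      replace 0 with (2 * (2 * alpha - 1) / alpha * (2 * r)
                      - 2 * (2 * alpha - 1) / alpha * (2 * r)) by ring.
      apply (is_derive_minus Z (base alpha 0));
        [apply ode_linearize; auto | apply is_derive_base]. }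
    (* With this constant the base of the integrand is exactly [Z], a positive real power of [y], so
       the first case of [is_power] applies. *)
    exists (F r0); split; [easy|].
    intros r Hr; exists (/ y r); split; [right; split; [exact NE|]|now apply Hf].
    rewrite (constant_on_itv a b F HF r0 r Hr0 Hr).
    replace (2 * (2 * alpha - 1) / alpha * r ^ 2 + F r) with (Z r)
      by (unfold F, base; ring).
    left; split; [apply Rpower_pos|].
    unfold Z; rewrite Rpower_mult.
    replace ((1 - / (2 * alpha)) * (2 * alpha / (1 - 2 * alpha)))
      with (- (1)) by (field; lra).
    rewrite Rpower_minus1; auto.
Qed.

(** * Admissible intervals and positivity of [base] *)

Definition in_domain (alpha m r : R) : Prop :=
  (alpha = 1 / 2 /\ 0 < m) \/ (alpha <> 1 / 2 /\ 0 < base alpha m r).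

Lemma in_domain_admissible (alpha m : R) (a b : Rbar) :
  alpha <> 0 -> Rbar_le 0 a -> Rbar_lt a b ->
  (forall r, itv a b r -> in_domain alpha m r) -> admissible alpha m a b.
Proof.
  intros Ha Ha0 Hab HD.
  assert (H : exists y : R -> R, forall r, itv a b r ->
     0 < y r /\ is_derive y r (8 * r * Rpower (y r) (/ (2 * alpha))) /\
     integrand alpha m r (/ y r)).
  { destruct (Req_dec alpha (1 / 2)) as [E|NE].
    (* In both cases [y] is the reciprocal of the integrand. *)
    - exists (fun r => / m * exp (4 * r ^ 2)); intros r Hr.
      assert (Hm : 0 < m) by (destruct (HD r Hr) as [[_ H]|[H _]]; [exact H | easy]).
      assert (Hp : 0 < / m * exp (4 * r ^ 2)).
      { apply Rmult_lt_0_compat; [now apply Rinv_0_lt_compat | apply exp_pos]. }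
      split; [exact Hp|]; split.
      + replace (/ (2 * alpha)) with 1 by (subst alpha; field).
        rewrite Rpower_1 by exact Hp.
        auto_derive; auto; simpl; ring.
      + left; split; [exact E|].
        replace (-4 * r ^ 2) with (- (4 * r ^ 2)) by ring.
        rewrite exp_Ropp; field.
        split; [apply Rgt_not_eq, exp_pos | lra].
    - exists (fun r => Rpower (base alpha m r) (2 * alpha / (2 * alpha - 1))).
      intros r Hr.
      assert (HB : 0 < base alpha m r).
      { destruct (HD r Hr) as [[H _]|[_ H]]; [easy | exact H]. }
      split; [apply Rpower_pos|]; split; [now apply base_ode|].
      right; split; [exact NE|]; left; split; [exact HB|].
      rewrite <- Rpower_Ropp; fold (base alpha m r); f_equal; field; lra. }
  destruct H as [y Hy].
  destruct (antiderivative_on a b (fun r => - / y r) Hab) as [f Hf].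
  { intros r Hr; destruct (Hy r Hr) as (H0 & D & _).
    apply (ex_derive_continuous (fun r => - / y r)).
    assert (ex_derive y r) by (eexists; exact D).
    auto_derive; repeat split; auto; lra. }
  exists f; split.
  - intros r Hr; exists (/ y r); split; [apply Hy, Hr | now apply Hf].
  - apply (ode_translator alpha a b f y); auto; intros r Hr; now apply Hy.
Qed.

(** A positive value excludes the zero base, and for a negative base with integer exponent
    [x^k = |x^k| = |x|^k]. Both signs of the base can then be handled by [Rpower]. *)
Lemma is_power_abs (x p Y : R) :
  is_power x p Y -> 0 < Y -> x <> 0 /\ Y = Rpower (Rabs x) p.
Proof.
  intros [[H ->]|[(_ & _ & H)|(H & k & -> & ->)]] HY.
  - split; [lra|]; now rewrite Rabs_pos_eq by lra.
  - lra.
  - split; [lra|].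
    rewrite <- powerRZ_Rpower by (apply Rabs_pos_lt; lra).
    rewrite <- (Rabs_pos_eq (powerRZ x k)) by lra.
    destruct k as [|k|k]; simpl.
    + apply Rabs_R1.
    + symmetry; apply RPow_abs.
    + now rewrite Rabs_inv, <- RPow_abs.
Qed.

(* Where the base is negative, [y ^ (1 - 1 / (2 alpha)) = - base], whose
   derivative has the wrong sign for the translator equation. *)
Lemma admissible_in_domain (alpha m : R) (a b : Rbar) :
  alpha <> 0 -> admissible alpha m a b ->
  forall r, itv a b r -> 0 < r /\ in_domain alpha m r.
Proof.
  intros Ha (f & HP & HT).
  assert (HO := translator_ode alpha a b f Ha HT).
  destruct HT as (Ha0 & _).
  assert (HI : forall r, itv a b r -> integrand alpha m r (- Derive f r)).
  { intros r Hr; destruct (HP r Hr) as (Y & HY & D).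
    now rewrite (is_derive_unique _ _ _ D), Ropp_involutive. }
  intros r Hr; assert (Hr0 := itv_pos a b r Ha0 Hr); split; [exact Hr0|].
  destruct (Req_dec alpha (1 / 2)) as [E|NE].
  - left; split; [exact E|].
    destruct (HO r Hr) as [Hn _]; destruct (HI r Hr) as [[_ HY]|[H _]]; [|easy].
    apply (Rmult_lt_reg_r (exp (-4 * r ^ 2))); [apply exp_pos | lra].
  - right; split; [exact NE|].
    set (p := 2 * alpha / (1 - 2 * alpha)) in *.
    assert (HB : forall s, itv a b s ->
              base alpha m s <> 0 /\
              - Derive f s = Rpower (Rabs (base alpha m s)) p).
    { intros s Hs; destruct (HO s Hs) as [Hn _].
      destruct (HI s Hs) as [[H _]|[_ H]]; [easy|].
      apply (is_power_abs _ _ _ H); lra. }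
    destruct (Rtotal_order (base alpha m r) 0) as [L|[Z|G]];
      [|now destruct (HB r Hr)|exact G].
    exfalso.
    (* Comparing derivatives at [r] requires the sign of the base on a whole neighbourhood. *)
    assert (HL : locally r (fun s => base alpha m s < 0)).
    { assert (C : continuous (base alpha m) r).
      { apply (ex_derive_continuous (base alpha m)).
        eexists; apply is_derive_base. }
      exact (C (fun z => z < 0) (open_lt 0 _ L)). }
    destruct (HO r Hr) as [Hn D].
    assert (Hy : 0 < - / Derive f r) by (apply Rinv_lt_0_compat in Hn; lra).
    assert (D1 := ode_linearize alpha r (fun s => - / Derive f s) Ha Hy D).
    assert (D2 : is_derive (fun s => Rpower (- / Derive f s) (1 - / (2 * alpha))) r
                   (- (2 * (2 * alpha - 1) / alpha * (2 * r)))).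
    { apply (is_derive_ext_loc (fun s => - base alpha m s));
        [|apply (is_derive_opp (base alpha m)), is_derive_base].
      generalize (filter_and _ _ HL (itv_locally a b r Hr)).
      apply filter_imp; intros s [Ls Hs].
      destruct (HB s Hs) as [_ E]; rewrite Rabs_left in E by exact Ls.
      destruct (HO s Hs) as [Hns _].
      replace (- / Derive f s) with (/ - Derive f s) by (field; lra).
      rewrite E, <- Rpower_Ropp, Rpower_mult.
      replace (- p * (1 - / (2 * alpha))) with 1 by (unfold p; field; lra).
      rewrite Rpower_1; lra. }
    (* A derivative equal to its own opposite is zero, which is impossible here since [r] is
       positive and [alpha] is not [1/2]. *)
    apply is_derive_unique in D1, D2; rewrite D1 in D2.
    assert (E0 : (2 * alpha - 1) / alpha * r = 0) by lra.
    apply Rmult_integral in E0; destruct E0 as [E0|E0]; [|lra].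
    apply Rmult_integral in E0; destruct E0 as [E0|E0]; [lra|].
    now apply (Rinv_neq_0_compat alpha Ha).
Qed.

(** * From the sign of [base] to the maximal domains *)

Lemma maximal_domain_of (alpha m : R) (a b : Rbar) :
  alpha <> 0 -> Rbar_le 0 a -> Rbar_lt a b ->
  (forall r, itv a b r -> in_domain alpha m r) ->
  (forall r, 0 < r -> in_domain alpha m r -> itv a b r) ->
  maximal_domain alpha m a b.
Proof.
  intros Ha Ha0 Hab H1 H2; split; [now apply in_domain_admissible|].
  intros a' b' HA r Hr.
  destruct (admissible_in_domain alpha m a' b' Ha HA r Hr); auto.
Qed.

Lemma no_domain_of (alpha m : R) :
  alpha <> 0 -> (forall r, 0 < r -> ~ in_domain alpha m r) -> no_domain alpha m.
Proof.
  intros Ha H a b HA.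
  assert (Hab : Rbar_lt a b) by now destruct HA as (f & _ & _ & Hab & _).
  destruct (itv_inhabited a b Hab) as [r Hr].
  destruct (admissible_in_domain alpha m a b Ha HA r Hr) as [H0 HD].
  exact (H r H0 HD).
Qed.

(** The subtracted term is the square of the finite endpoint in the theorem; the sign of the leading
    factor decides on which side of it [base] is positive. *)
Lemma base_factor (alpha m r : R) :
  alpha <> 0 -> alpha <> 1 / 2 ->
  base alpha m r =
    2 * (2 * alpha - 1) / alpha * (r ^ 2 - alpha / (2 * (1 - 2 * alpha)) * m).
Proof. intros; unfold base; field; lra. Qed.

Lemma lt_sqrt_iff (r x : R) : 0 < r -> 0 <= x -> r < sqrt x <-> r ^ 2 < x.
Proof.
  intros Hr Hx.
  assert (H : 0 <= r ^ 2) by apply pow2_ge_0.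
  rewrite <- (sqrt_pow2 r) at 1 by lra; split; [apply sqrt_lt_0|]; auto.
  intros; now apply sqrt_lt_1.
Qed.

Lemma sqrt_lt_iff (r x : R) : 0 < r -> 0 <= x -> sqrt x < r <-> x < r ^ 2.
Proof.
  intros Hr Hx.
  assert (H : 0 <= r ^ 2) by apply pow2_ge_0.
  rewrite <- (sqrt_pow2 r) at 1 by lra; split; [apply sqrt_lt_0|]; auto.
  intros; now apply sqrt_lt_1.
Qed.

Theorem theorem4p11 (alpha : R) (halpha : alpha <> 0) :
  (forall (a b : Rbar) (f : R -> R),
     rot_translator alpha a b f ->
     exists m : R, (alpha = 1 / 2 -> 0 < m) /\ profile alpha m a b f) /\
  (forall m : R,
     (alpha = 1 / 2 ->
        (0 < m -> maximal_domain alpha m 0 p_infty) /\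
        (m <= 0 -> no_domain alpha m)) /\
     (0 < alpha < 1 / 2 ->
        (0 < m ->
           maximal_domain alpha m 0 (sqrt (alpha / (2 * (1 - 2 * alpha)) * m))) /\
        (m <= 0 -> no_domain alpha m)) /\
     (~ (0 <= alpha <= 1 / 2) ->
        (0 <= m -> maximal_domain alpha m 0 p_infty) /\
        (m < 0 ->
           maximal_domain alpha m (sqrt (alpha / (2 * (1 - 2 * alpha)) * m))
             p_infty))).
Proof.
  split; [intros a b f; now apply translator_profile|].
  intros m; split; [|split]; intros Hal.
  - split; intros Hm.
    + apply maximal_domain_of; simpl; auto; [lra| |].
      * intros r _; now left.
      * intros r Hr _; now split.
    + apply no_domain_of; auto; intros r _ [[_ H]|[H _]]; [lra | easy].
  - assert (NE : alpha <> 1 / 2) by lra.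
    (* A negative leading factor makes [base] positive below the endpoint, and nowhere if
       [m <= 0]. *)
    assert (Hc : 2 * (2 * alpha - 1) / alpha < 0).
    { assert (0 < / alpha) by (apply Rinv_0_lt_compat; lra); unfold Rdiv; nra. }
    split; intros Hm.
    + set (x := alpha / (2 * (1 - 2 * alpha)) * m).
      assert (Hx : 0 < x).
      { unfold x; apply Rmult_lt_0_compat; [apply Rdiv_lt_0_compat|]; lra. }
      apply maximal_domain_of; simpl; auto; [lra| now apply sqrt_lt_R0 | |].
      * intros r [Hr0 Hr]; simpl in Hr0, Hr; right; split; [exact NE|].
        apply lt_sqrt_iff in Hr; try lra.
        rewrite base_factor by assumption; fold x; nra.
      * intros r Hr [[H _]|[_ H]]; [easy|].
        rewrite base_factor in H by assumption; fold x in H.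
        split; simpl; [exact Hr|]; apply lt_sqrt_iff; try lra; nra.
    + apply no_domain_of; auto; intros r Hr [[H _]|[_ H]]; [easy|].
      unfold base in H; assert (0 < r ^ 2) by now apply pow_lt.
      nra.
  - assert (NE : alpha <> 1 / 2) by lra.
    (* For [alpha < 0] numerator and denominator are both negative, for [alpha > 1/2] both positive;
       [base] is then positive above the endpoint. *)
    assert (Hc : 0 < 2 * (2 * alpha - 1) / alpha).
    { destruct (Rlt_or_le alpha 0) as [H|H].
      - assert (/ alpha < 0) by (apply Rinv_lt_0_compat; lra); unfold Rdiv; nra.
      - apply Rdiv_lt_0_compat; lra. }
    split; intros Hm.
    + apply maximal_domain_of; simpl; auto; [lra| |].
      * intros r [Hr _]; simpl in Hr; right; split; [exact NE|].
        unfold base; assert (0 < r ^ 2) by now apply pow_lt.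
        nra.
      * intros r Hr _; now split.
    + set (x := alpha / (2 * (1 - 2 * alpha)) * m).
      assert (Hx : 0 <= x).
      { apply Rnot_lt_le; intros Hx.
        (* At [r = 0] the factorization reads [m = - c x] with leading factor [c > 0], so [m < 0]
           excludes [x < 0]. *)
        assert (E : base alpha m 0 = m) by (unfold base; ring).
        rewrite base_factor in E by assumption; fold x in E; nra. }
      apply maximal_domain_of; simpl; auto; [apply sqrt_pos| |].
      * intros r [Hr _]; simpl in Hr; right; split; [exact NE|].
        assert (Hr0 : 0 < r) by (assert (0 <= sqrt x) by apply sqrt_pos; lra).
        apply sqrt_lt_iff in Hr; try lra.
        rewrite base_factor by assumption; fold x; nra.
      * intros r Hr [[H _]|[_ H]]; [easy|].
        rewrite base_factor in H by assumption; fold x in H.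
        split; simpl; [|easy]; apply sqrt_lt_iff; try lra; nra.
Qed.
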